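(* Let $(X, \mu)$ be a probability space with a measure-preserving action of $\mathbb{Z}^2$, and let $f \in L^\infty(X)$ be integer-valued with $\mathrm{Ann}(f) \neq \{0\}$. Then there exists a finite set $\Delta \subseteq \mathbb{Z}^2 \setminus \{0\}$ such that: (1) no two distinct elements of $\Delta$ are proportional to each other; (2) the function $f_0 = f - \sum_{g \in \Delta} f^g$ is periodic; (3) for every integer $l \geq 1$ and every $g \in \Delta$, the function $f^{lg} - f^g$ is periodic.
   Context: $R = \mathbb{Z}[u_1^{\pm 1}, u_2^{\pm 1}]$; for $g = (n_1,n_2)$, $u^g = u_1^{n_1}u_2^{n_2}$. $L^2(X)$ is an $R$-module via $(\sum_g c_g u^g)\cdot \phi\,(x) = \sum_g c_g \phi((-g)\cdot x)$; in particular $(u^g\cdot\phi)(x) = \phi((-g)\cdot x)$. $\mathrm{Ann}(f) = \{p \in R : p\cdot f = 0\}$. For $g \in \mathbb{Z}^2$, $H_g = \{\phi \in L^2(X) : u^g\cdot \phi = \phi\}$, and $f^g$ denotes the orthogonal projection of $f$ onto $H_g$. A function $\phi \in L^2(X)$ is periodic if there is a finite index subgroup $\Lambda \subseteq \mathbb{Z}^2$ with $u^h\cdot\phi = \phi$ for all $h \in \Lambda$. Two elements of $\mathbb{Z}^2$ are proportional if they are linearly dependent over $\mathbb{Q}$. *)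

(* Defs.v *)
From mathcomp Require Import all_boot all_order all_algebra finmap.
From mathcomp Require Import all_classical all_reals all_analysis.

Set Implicit Arguments.
Unset Strict Implicit.
Unset Printing Implicit Defensive.
Import Order.TTheory GRing.Theory Num.Theory.
Import numFieldNormedType.Exports.

Local Open Scope classical_set_scope.
Local Open Scope ring_scope.

Notation Z2 := (int * int)%type.

(* Z[u_1^{+-1}, u_2^{+-1}]: the Laurent polynomial \sum_g c_g u^g is its
   finitely supported coefficient function g |-> c_g, and [fsfun] is 0.
   Only the underlying set and the action on functions are needed. *)
Definition laurent : Type := {fsfun Z2 -> int with 0}.

Definition proportional (g h : Z2) : Prop :=
  ~~ free [:: ((g.1%:Q, g.2%:Q) : rat^o * rat^o);
              ((h.1%:Q, h.2%:Q) : rat^o * rat^o)].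

(* The cosets of L are the sets {h | h - g \in L}. *)
Definition finite_index_subgroup (L : {pred Z2}) : Prop :=
  zmod_closed L /\
  finite_set (range (fun g : Z2 => [set h : Z2 | h - g \in L])).

Section Action.
Context d (X : measurableType d) (R : realType) (mu : probability X R).

Definition measure_preserving_action (a : Z2 -> X -> X) : Prop :=
  [/\ forall x, a 0 x = x,
      forall g h x, a (g + h) x = a g (a h x),
      forall g, measurable_fun setT (a g) &
      forall g (A : set X), measurable A -> mu (a g @^-1` A) = mu A].

(* Elements of L^p(X) are represented by functions in Lfun mu p; two of them
   are the same element of L^p(X) when they are equal mu-almost everywhere. *)

Definition inner (phi psi : X -> R) : R := \int[mu]_x (phi x * psi x).

Definition is_orth_proj (H : set (X -> R)) (phi p : X -> R) : Prop :=
  H p /\ forall psi, H psi -> inner (phi \- p) psi = 0.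

(* A representative of the orthogonal projection of phi onto the closed
   subspace H of L^2(X); it is unique up to mu-almost everywhere equality.
   The default value 0 is never used when H is closed and phi is in L^2(X). *)
Definition orth_proj (H : set (X -> R)) (phi : X -> R) : X -> R :=
  xget (cst 0) [set p | is_orth_proj H phi p].

Variable a : Z2 -> X -> X.

Definition umul (g : Z2) (phi : X -> R) : X -> R := fun x => phi (a (- g) x).

Definition laurent_act (p : laurent) (phi : X -> R) : X -> R :=
  fun x => \sum_(g <- finsupp p) (p g)%:~R * umul g phi x.

Definition Ann (phi : X -> R) : set laurent :=
  [set p | laurent_act p phi = cst 0 %[ae mu]].

Definition invariant_space (g : Z2) : set (X -> R) :=
  [set phi | phi \in Lfun mu 2%:E /\ umul g phi = phi %[ae mu]].

Definition iproj (phi : X -> R) (g : Z2) : X -> R :=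
  orth_proj (invariant_space g) phi.

Definition periodic_L2 (phi : X -> R) : Prop :=
  phi \in Lfun mu 2%:E /\
  exists2 L : {pred Z2}, finite_index_subgroup L &
    forall h, h \in L -> umul h phi = phi %[ae mu].

End Action.

(* Main.v *)
From HB Require Import structures.
Require Import Defs.
From mathcomp Require Import all_boot all_order all_algebra finmap.
From mathcomp Require Import all_classical all_reals all_analysis.
From mathcomp Require Import zify ring lra.

Set Implicit Arguments.
Unset Strict Implicit.
Unset Printing Implicit Defensive.
Import Order.TTheory GRing.Theory Num.Theory.
Import numFieldNormedType.Exports measurable_realfun.

Local Open Scope classical_set_scope.
Local Open Scope ring_scope.

(* Write P = sum_g c_g u^g with P f = 0.  For a prime q the polynomial P^q is
   congruent mod q to the dilation sum_g c_g u^(qg), so q divides the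
   integer-valued function sum_g c_g u^(qg) f; once q exceeds
   (sum_g |c_g|) ||f||_oo this function vanishes.  Iterating over primes, with M
   the factorial of that bound, every dilation by 1 + kM annihilates f.
   Multiplying by u^(-(1+kM) g0), g0 in the support, and averaging over k,
   the mean ergodic theorem gives
     c_g0 f = - sum_(g <> g0) c_g u^(g - g0) f^(M(g - g0)),
   so f is a finite sum of functions each invariant under a nonzero vector.
   Grouping proportional vectors, f = sum_(w in Delta) psi_w with psi_w in H_w.
   Finally f^(lw) - psi_w is the sum over x <> w of the projections of psi_x to
   H_(lw); each of these is invariant under both x and lw, hence periodic. *)

(** * Dilation of annihilating polynomials *)

Section CoefSum.
Context {A : nzRingType} {V : zmodType}.

(** An additive functional on polynomials prescribed degree by degree; nesting it twice handles two
    variables. *)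
Definition coef_sum (l : nat -> {additive A -> V}) (p : {poly A}) : V :=
  \sum_(i < size p) l i p`_i.

(** Padding with zero coefficients lets polynomials of different sizes be summed over a common
    range. *)
Lemma coef_sumE (l : nat -> {additive A -> V}) (p : {poly A}) n :
  (size p <= n)%N -> coef_sum l p = \sum_(i < n) l i p`_i.
Proof.
move=> pn; rewrite /coef_sum -!(big_mkord xpredT (fun i => l i p`_i)).
rewrite [RHS](big_cat_nat (n := size p))//= [X in _ = _ + X]big_nat_cond.
rewrite [X in _ = _ + X]big1 ?addr0// => i /andP[/andP[pi _] _].
by rewrite nth_default// raddf0.
Qed.

Lemma coef_sum_is_additive l : zmod_morphism (coef_sum l).
Proof.
move=> p q; set n := maxn (size p) (size q).
have spq : (size (p - q)%R <= n)%N.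
  by rewrite (leq_trans (size_polyD _ _))// size_polyN.
rewrite !(@coef_sumE _ _ n) ?leq_maxl ?leq_maxr//.
by rewrite -sumrB; apply: eq_bigr => i _; rewrite coefB raddfB.
Qed.

HB.instance Definition _ l :=
  GRing.isZmodMorphism.Build {poly A} V (coef_sum l) (coef_sum_is_additive l).

Lemma coef_sumMX l p : coef_sum l (p * 'X) = coef_sum (fun i => l i.+1) p.
Proof.
rewrite (@coef_sumE _ (p * 'X) (size p).+1) ?big_ord_recl; last first.
  by rewrite (leq_trans (size_polyMleq _ _))// size_polyX addn2.
rewrite coefMX eqxx raddf0 add0r; apply: eq_bigr => i _.
by rewrite coefMX.
Qed.

Lemma coef_sumC l c : coef_sum l c%:P = l 0 c.
Proof.
rewrite (@coef_sumE _ _ 1) ?size_polyC_leq1//.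
by rewrite big_ord1 coefC eqxx.
Qed.

End CoefSum.

(** * Polynomials acting on functions on Z^2, and the Frobenius map *)

Section Frobenius.
Context {K : comNzRingType}.
Implicit Types (F : Z2 -> K) (h : Z2).

(* [pair2 F h] sends X^i Y^j to [F (h + (i, j))], so that multiplication by the
   variables is dual to the unit shifts; it replaces a group algebra of Z^2. *)
Definition pair1 F (h : Z2) : {additive {poly K} -> K} :=
  coef_sum (fun j => F (h + (0, j%:Z)) \o* idfun).

Definition pair2 F (h : Z2) : {additive {poly {poly K}} -> K} :=
  coef_sum (fun i => pair1 F (h + (i%:Z, 0))).

Lemma pair1MX F h p : pair1 F h (p * 'X) = pair1 F (h + (0, 1)) p.
Proof.
rewrite /pair1/= coef_sumMX; apply: eq_bigr => i _ /=.
by rewrite -addrA; congr (_ * F (h + (_, _))); rewrite -?intS; lia.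
Qed.

Lemma pair1C F h c : pair1 F h c%:P = c * F h.
Proof. by rewrite /pair1/= coef_sumC/= addr0. Qed.

Lemma pair2MX F h p : pair2 F h (p * 'X) = pair2 F (h + (1, 0)) p.
Proof.
rewrite /pair2/= coef_sumMX; apply: eq_bigr => i _ /=.
by rewrite -addrA; congr (pair1 F (h + (_, _)) _); lia.
Qed.

Lemma pair2MY F h p : pair2 F h (p * 'X%:P) = pair2 F (h + (0, 1)) p.
Proof.
rewrite /pair2/= (@coef_sumE _ _ _ (p * _) (size p)); last first.
  by rewrite mulrC mul_polyC size_scale_leq.
apply: eq_bigr => i _; rewrite coefMC pair1MX; congr (pair1 F _ _).
by rewrite addrAC.
Qed.

Lemma pair2Z F h c p : pair2 F h (p * c%:P%:P) = c * pair2 F h p.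
Proof.
rewrite /pair2/= (@coef_sumE _ _ _ (p * _) (size p)); last first.
  by rewrite mulrC mul_polyC size_scale_leq.
rewrite big_distrr; apply: eq_bigr => i _ /=; rewrite coefMC.
rewrite /pair1/= (@coef_sumE _ _ _ (_ * _) (size p`_i)); last first.
  by rewrite mulrC mul_polyC size_scale_leq.
rewrite big_distrr; apply: eq_bigr => j _ /=; rewrite coefMC.
by rewrite mulrAC mulrC.
Qed.

Lemma pair2C F h c : pair2 F h c%:P%:P = c * F h.
Proof. by rewrite /pair2/= coef_sumC pair1C addr0. Qed.

Definition monom2 (v : nat * nat) : {poly {poly K}} := 'X^(v.1) * ('X^(v.2))%:P.

Lemma pair2_monom F h p (v : nat * nat) :
  pair2 F h (p * monom2 v) = pair2 F (h + (v.1%:Z, v.2%:Z)) p.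
Proof.
rewrite /monom2 mulrA; case: v => i j /=.
have -> : pair2 F h (p * 'X^i * ('X^j)%:P) =
    pair2 F (h + (0, j%:Z)) (p * 'X^i).
  elim: j h => [|j IH] h; first by rewrite expr0 mulr1 addr0.
  rewrite exprS polyCM mulrCA mulrC pair2MY IH -addrA.
  by congr (pair2 F (h + (_, _)) _); lia.
elim: i h => [|i IH] h; first by rewrite mulr1.
rewrite exprS mulrA -mulrA [X in _ * X]mulrC mulrA pair2MX addrAC IH.
by rewrite -addrA; congr (pair2 F (h + (_, _)) _); lia.
Qed.

(** The annihilator of F is an ideal: multiplying by a variable only moves the base point h, and the
    hypothesis covers all base points. The induction runs over powers of X, then over powers of Y
    inside a coefficient. *)
Lemma pair2_eq0 F P : (forall h, pair2 F h P = 0) ->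
  forall Q h, pair2 F h (P * Q) = 0.
Proof.
move=> P0; elim/poly_ind => [|Q q IH] h; first by rewrite mulr0 raddf0.
rewrite mulrDr mulrA (raddfD (pair2 F h)) pair2MX IH add0r.
elim/poly_ind: q h => [|q c IHq] h; first by rewrite mulr0 raddf0.
by rewrite polyCD polyCM mulrDr mulrA (raddfD (pair2 F h)) pair2MY IHq
  pair2Z P0 mulr0 addr0.
Qed.

End Frobenius.

(** Over the prime field, P^q is the dilation of P with the same coefficients, and as a multiple of
    P it still annihilates F mod q. Exponents are natural numbers here so that ordinary polynomials
    suffice. *)
Lemma sum_dilation_Fp (q : nat) (I : Type) (S : seq I) (c : I -> int)
    (v : I -> nat * nat) (F : Z2 -> int) : prime q ->
  (forall h, \sum_(i <- S) c i * F (h + ((v i).1%:Z, (v i).2%:Z)) = 0) ->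
  forall h, (q %| \sum_(i <- S) c i * F (h + ((v i).1%:Z, (v i).2%:Z) *+ q))%Z.
Proof.
move=> q_pr S0 h; pose G (g : Z2) : 'F_q := (F g)%:~R.
pose P : {poly {poly 'F_q}} := \sum_(i <- S) monom2 (v i) * (c i)%:~R%:P%:P.
have pchF : q \in [pchar 'F_q] := pchar_Fp q_pr.
have pchP : q \in [pchar {poly {poly 'F_q}}] by rewrite !pchar_poly.
have pairE (w : I -> nat * nat) k : pair2 G k
    (\sum_(i <- S) monom2 (w i) * (c i)%:~R%:P%:P) =
    (\sum_(i <- S) c i * F (k + ((w i).1%:Z, (w i).2%:Z)))%:~R.
  rewrite raddf_sum rmorph_sum/=; apply: eq_bigr => i _.
  by rewrite pair2Z -[monom2 _]mul1r pair2_monom pair2C mul1r intrM.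
have P0 k : pair2 G k P = 0 by rewrite pairE S0.
(* Frobenius is additive in characteristic q and fixes the images of integers. *)
have Pq : P ^+ q = \sum_(i <- S)
    monom2 ((v i).1 * q, (v i).2 * q)%N * (c i)%:~R%:P%:P.
  rewrite -(pFrobenius_autE pchP) rmorph_sum/=; apply: eq_bigr => i _.
  rewrite pFrobenius_autE exprMn -!polyC_exp.
  rewrite -(pFrobenius_autE pchF (c i)%:~R) rmorph_int; congr (_ * _).
  by rewrite /monom2 exprMn -polyC_exp -!exprM.
have Pn0 n : (0 < n)%N -> pair2 G h (P ^+ n) = 0.
  by case: n => // n _; rewrite exprS pair2_eq0.
have := pairE (fun i => ((v i).1 * q, (v i).2 * q)%N) h.
rewrite -Pq Pn0 ?prime_gt0// => /esym/eqP; rewrite -(dvdz_pcharf pchF).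
congr (_ %| _)%Z; apply: eq_bigr => i _; congr (_ * F (h + _)).
by rewrite pairMnE/= !PoszM !pmulrn !mulrzz.
Qed.

(** Negative exponents are removed by multiplying by a monomial, that is, by translating all v i by
    one vector t. *)
Lemma sum_dilation_mod (q : nat) (I : eqType) (S : seq I) (c : I -> int)
    (v : I -> Z2) (F : Z2 -> int) : prime q ->
  (forall h, \sum_(i <- S) c i * F (h + v i) = 0) ->
  forall h, (q %| \sum_(i <- S) c i * F (h + v i *+ q))%Z.
Proof.
move=> q_pr S0 h.
pose N : nat := (\sum_(i <- S) (`|(v i).1|%N + `|(v i).2|%N))%N.
have Nv i : i \in S -> (`|(v i).1|%N + `|(v i).2|%N <= N)%N.
  by move=> iS; rewrite /N (big_rem i)//= leq_addr.
pose w i : nat * nat := (absz ((v i).1 + N%:Z), absz ((v i).2 + N%:Z)).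
pose t : Z2 := (N%:Z, N%:Z).
have wE i : i \in S -> ((w i).1%:Z, (w i).2%:Z) = v i + t.
  move=> /Nv iN; rewrite [RHS]surjective_pairing /=.
  by congr pair; rewrite gez0_abs//; lia.
have S0' k : \sum_(i <- S) c i * F (k + ((w i).1%:Z, (w i).2%:Z)) = 0.
  rewrite -[RHS](S0 (k + t)); apply: eq_big_seq => i iS.
  by rewrite wE// (addrC _ t) addrA.
(* The dilation turns t into qt, which the base point compensates. *)
have := sum_dilation_Fp q_pr S0' (h - t *+ q).
congr (_ %| _)%Z; apply: eq_big_seq => i iS.
by rewrite wE// mulrnDl addrACA addNr addr0.
Qed.

(** An integer divisible by q and smaller than q in absolute value is 0. *)
Lemma sum_dilation_prime (q : nat) (I : eqType) (S : seq I) (c : I -> int)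
    (v : I -> Z2) (F : Z2 -> int) (C : nat) : prime q ->
  (forall h, (`|F h|%N <= C)%N) -> (\sum_(i <- S) `|c i|%N * C < q)%N ->
  (forall h, \sum_(i <- S) c i * F (h + v i) = 0) ->
  forall h, \sum_(i <- S) c i * F (h + v i *+ q) = 0.
Proof.
move=> q_pr FC Cq S0 h; have := sum_dilation_mod q_pr S0 h.
set s := (X in (_ %| X)%Z) => qs; suff sq : (`|s| < q)%N.
  apply/eqP; rewrite -absz_eq0; apply/negPn; rewrite -lt0n; apply/negP => s0.
  by have := dvdn_leq s0 qs; rewrite leqNgt sq.
apply: leq_ltn_trans Cq; rewrite {S0 qs}/s.
elim: S => [|i S IH]; rewrite ?big_nil ?big_cons//.
have absD (a b : int) : (absz (a + b)%R <= absz a + absz b)%N by lia.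
by rewrite (leq_trans (absD _ _))// leq_add// abszM leq_mul.
Qed.

(** Prime factors of n are applied one at a time; dilation leaves the coefficients alone, so the
    same bound serves at every stage. *)
Lemma sum_dilation (n : nat) (I : eqType) (S : seq I) (c : I -> int)
    (v : I -> Z2) (F : Z2 -> int) (C : nat) : (0 < n)%N ->
  (forall h, (`|F h|%N <= C)%N) ->
  (forall q, prime q -> (q %| n)%N -> (\sum_(i <- S) `|c i|%N * C < q)%N) ->
  (forall h, \sum_(i <- S) c i * F (h + v i) = 0) ->
  forall h, \sum_(i <- S) c i * F (h + v i *+ n) = 0.
Proof.
(* The bound m on n makes the induction strong, as the next case is n divided by a prime. *)
move=> n0 FC + S0; move: {2}n (leqnn n) => m.
elim: m n n0 => [|m IH] n n0 nm nC h; first by lia.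
have [n1|n1] := leqP n 1; first by have -> : n = 1%N by lia.
have q_pr := pdiv_prime n1; have qn := pdiv_dvd n.
have q1 := prime_gt1 q_pr.
have nE : n = (n %/ pdiv n * pdiv n)%N by rewrite divnK.
have S0m k : \sum_(i <- S) c i * F (k + v i *+ (n %/ pdiv n)) = 0.
  apply: IH => [||q qp qd]; [nia|nia|apply: nC => //].
  by rewrite nE dvdn_mulr.
have := sum_dilation_prime q_pr FC (nC _ q_pr qn) S0m h.
by under eq_bigr do rewrite -mulrnA -nE.
Qed.

(** Every prime up to the bound divides its factorial M, hence cannot divide kM + 1. *)
Lemma sum_dilation_progression (I : eqType) (S : seq I) (c : I -> int)
    (v : I -> Z2) (F : Z2 -> int) (C : nat) :
  let M := (\sum_(i <- S) `|c i|%N * C)`! in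
  (forall h, (`|F h|%N <= C)%N) ->
  (forall h, \sum_(i <- S) c i * F (h + v i) = 0) ->
  forall k h, \sum_(i <- S) c i * F (h + v i *+ (k * M).+1) = 0.
Proof.
move=> M FC S0 k h; apply: sum_dilation FC _ S0 h => // q q_pr.
apply: contraTT; rewrite -leqNgt => qB; rewrite -addn1 dvdn_addr.
  by rewrite dvdn1 neq_ltn prime_gt1 ?orbT.
by rewrite dvdn_mull// dvdn_fact// prime_gt0.
Qed.

(** * Convergence of ergodic averages in a seminormed space *)

Lemma eq0_of_le_pos {R : realType} (x : R) :
  (forall e, 0 < e -> x <= e) -> 0 <= x -> x = 0.
Proof.
move=> xe x0; apply/eqP; rewrite eq_le x0 andbT.
by apply/ler_addgt0Pl => e e0; rewrite addr0 xe.
Qed.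

Lemma div_nat_le {R : realType} (C e : R) : 0 < e ->
  exists N, forall n, (N <= n)%N -> C / n%:R <= e.
Proof.
move=> e0; exists (Num.truncn (`|C| / e)).+1 => n Nn.
have n0 : 0 < n%:R :> R by rewrite ltr0n (leq_trans _ Nn).
rewrite ler_pdivrMr// mulrC -ler_pdivrMr//.
rewrite (le_trans (y := `|C| / e)) ?ler_wpM2r ?invr_ge0 ?ler_norm ?ltW//.
by rewrite (lt_le_trans (truncnS_gt _))// ler_nat.
Qed.

(** A seminorm is the right setting: vectors will be functions rather than classes, and a function
    vanishing almost everywhere has norm 0 without being 0. *)
Section MeanErgodic.
Context {R : realType} {V : lmodType R} (nm : V -> R).
Context (nmZ : forall a v, nm (a *: v) = `|a| * nm v)
  (nmD : forall v w, nm (v + w) <= nm v + nm w)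
  (nm_parallelogram : forall v w,
    nm (v + w) ^+ 2 + nm (v - w) ^+ 2 = 2 * nm v ^+ 2 + 2 * nm w ^+ 2).
Context (U : {linear V -> V}) (nmU : forall v, nm (U v) = nm v).

Lemma seminormN v : nm (- v) = nm v.
Proof. by rewrite -scaleN1r nmZ normrN1 mul1r. Qed.

Lemma seminorm0 : nm 0 = 0.
Proof. by rewrite -(scale0r 0) nmZ normr0 mul0r. Qed.

Lemma seminorm_ge0 v : 0 <= nm v.
Proof. by have := nmD v (- v); rewrite subrr seminorm0 seminormN; lra. Qed.

Lemma iter_seminorm k v : nm (iter k U v) = nm v.
Proof. by elim: k => //= k IH; rewrite nmU. Qed.

Definition avg n v : V := n%:R^-1 *: \sum_(k < n) iter k U v.

Lemma avgD n v w : avg n (v + w) = avg n v + avg n w.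
Proof.
rewrite /avg -scalerDr -big_split/=; congr (_ *: _); apply: eq_bigr => k _.
by elim: (k : nat) => //= {}k ->; rewrite linearD.
Qed.

Lemma avgZ n a v : avg n (a *: v) = a *: avg n v.
Proof.
rewrite /avg scalerA mulrC -scalerA; congr (_ *: _); rewrite scaler_sumr.
by apply: eq_bigr => k _; elim: (k : nat) => //= {}k ->; rewrite linearZ.
Qed.

Lemma seminorm_avg n v : nm (avg n v) <= nm v.
Proof.
case: n => [|n]; first by rewrite /avg big_ord0 scaler0 seminorm0 seminorm_ge0.
rewrite /avg nmZ ger0_norm ?invr_ge0// ler_pdivrMl ?ltr0n//.
elim: n.+1 => [|k IH]; first by rewrite big_ord0 seminorm0 mul0r.
rewrite big_ord_recr/= -natr1 mulrDl mul1r (le_trans (nmD _ _))//.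
by rewrite iter_seminorm lerD2r.
Qed.

Lemma avg_shift n v : avg n (U v) - avg n v = n%:R^-1 *: (iter n U v - v).
Proof.
rewrite /avg -scalerBr; congr (_ *: _).
rewrite -sumrB -(big_mkord xpredT (fun k => iter k U (U v) - iter k U v)).
rewrite -[v in RHS]/(iter 0 U v).
rewrite -(@telescope_sumr _ 0 n (fun k => iter k U v))//.
by apply: eq_bigr => k _; rewrite -iterSr.
Qed.

Lemma seminorm_avg_shift n v : nm (avg n (U v) - avg n v) <= 2 * nm v / n%:R.
Proof.
rewrite avg_shift nmZ ger0_norm ?invr_ge0// mulrC ler_wpM2r ?invr_ge0//.
by rewrite (le_trans (nmD _ _))// seminormN iter_seminorm; lra.
Qed.

(** The convex hull of the forward orbit of f, generated inductively so that estimates on averages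
    propagate along its constructors. *)
Inductive orbit_hull (f : V) : V -> Prop :=
| OrbitHull1 : orbit_hull f f
| OrbitHullU v of orbit_hull f v : orbit_hull f (U v)
| OrbitHullC t v w of 0 <= t <= 1 & orbit_hull f v & orbit_hull f w :
    orbit_hull f (t *: v + (1 - t) *: w).

Lemma orbit_hull_avg f n : orbit_hull f (avg n.+1 f).
Proof.
have iterH k : orbit_hull f (iter k U f).
  by elim: k => [|k IH] /=; constructor.
elim: n => [|n IH]; first by rewrite /avg big_ord1 invr1 scale1r; constructor.
have -> : avg n.+2 f = (n.+1%:R / n.+2%:R) *: avg n.+1 f +
    (1 - n.+1%:R / n.+2%:R) *: iter n.+1 U f.
  have n1 : n.+1%:R != 0 :> R by rewrite pnatr_eq0.
  have n2 : n.+2%:R != 0 :> R by rewrite pnatr_eq0.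
  rewrite {1}/avg big_ord_recr scalerDr /avg scalerA; congr (_ *: _ + _ *: _).
    by rewrite mulrAC mulfV// mul1r.
  by apply: (mulIf n2); rewrite mulVf// mulrBl mul1r divfK// -natrB ?subSnn.
apply: OrbitHullC IH (iterH n.+1).
by rewrite divr_ge0//= ler_pdivrMr ?ltr0n// mul1r ler_nat.
Qed.

(** Applying U changes the n-th average by O(1/n), and averaging is linear, so convex combinations
    preserve such a bound. *)
Lemma orbit_hull_avg_close f v : orbit_hull f v ->
  exists B, forall n, nm (avg n v - avg n f) <= B / n%:R.
Proof.
elim=> [|{}v _ [B vB]|t {}v w /andP[t0 t1] _ [B vB] _ [C wC]].
- by exists 0 => n; rewrite subrr seminorm0 mul0r.
- exists (2 * nm v + B) => n; rewrite -[_ - _](subrKA (avg n v)).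
  by rewrite (le_trans (nmD _ _))// mulrDl lerD// seminorm_avg_shift.
- exists (t * B + (1 - t) * C) => n.
  have -> : avg n (t *: v + (1 - t) *: w) - avg n f =
      t *: (avg n v - avg n f) + (1 - t) *: (avg n w - avg n f).
    rewrite avgD !avgZ !scalerBr addrACA -opprD -scalerDl.
    by rewrite [t + _]addrC subrK scale1r.
  rewrite (le_trans (nmD _ _))// !nmZ !ger0_norm ?subr_ge0//.
  rewrite [leRHS]mulrDl -[t * B / _]mulrA -[_ * C / _]mulrA.
  by rewrite lerD// ler_wpM2l// subr_ge0.
Qed.

(* F. Riesz's argument: the norms of the averages tend to the infimum of the
   seminorm over the convex hull of the orbit, because averaging contracts any
   near-minimizer; the parallelogram law then makes the averages Cauchy. *)
Lemma mean_ergodic_cauchy f (e : R) : 0 < e ->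
  exists N, forall p q, (N <= p)%N -> (N <= q)%N ->
    nm (avg p f - avg q f) ^+ 2 <= e.
Proof.
move=> e0; pose A := [set nm v | v in orbit_hull f]; pose m := inf A.
have A0 : A !=set0 by exists (nm f), f => //; constructor.
have Alb : lbound A 0 by move=> _ [v _ <-]; exact: seminorm_ge0.
have mA v : orbit_hull f v -> m <= nm v.
  by move=> fv; apply: ge_inf; [exists 0|exists v].
have m0 : 0 <= m by apply: lb_le_inf.
(* If two vectors have norm at most m + 2d and their midpoint has norm at least m, the parallelogram
   law bounds the squared norm of their difference by 4(m + 2d)^2 - 4m^2 = 16d(m + d). Since d <= 1
   and 16(m + 1)d <= e, this is at most e. *)
pose d := Num.min 1 (e / (16 * (m + 1))).
have d0 : 0 < d.
  by rewrite lt_min ltr01 divr_gt0// mulr_gt0// ltr_wpDl.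
have d1 : d <= 1 by rewrite ge_min lexx.
have dm : 16 * (m + 1) * d <= e.
  by rewrite mulrC -ler_pdivlMr ?ge_min ?lexx ?orbT// mulr_gt0// ltr_wpDl.
have [_ [v fv <-] vm] := @inf_adherent _ A d d0 (conj A0 (ex_intro _ 0 Alb)).
have [B vB] := orbit_hull_avg_close fv.
have [N NP] := div_nat_le B d0.
(* The near-minimizer v has norm below m + d, averaging does not increase it, and the averages of f
   and v are within d. *)
have small n : (N <= n)%N -> 0 <= nm (avg n f) <= m + 2 * d.
  move=> /NP Bd; rewrite seminorm_ge0 -[avg n f](subKr (avg n v)).
  rewrite (le_trans (nmD _ _))// seminormN.
  have := seminorm_avg n v; have := vB n; move: vm; rewrite -/m; lra.
(* The successor excludes the empty average, which need not lie in the hull. *)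
exists N.+1 => -[//|p] [//|q] Np Nq.
have := nm_parallelogram (avg p.+1 f) (avg q.+1 f).
have /andP[p0 pd] := small _ (ltnW Np); have /andP[q0 qd] := small _ (ltnW Nq).
have : 2 * m <= nm (avg p.+1 f + avg q.+1 f).
  have /mA : orbit_hull f (2^-1 *: avg p.+1 f + (1 - 2^-1) *: avg q.+1 f).
    by apply: OrbitHullC; [lra|exact: orbit_hull_avg|exact: orbit_hull_avg].
  have -> : 1 - 2^-1 = 2^-1 :> R by lra.
  by rewrite -scalerDr nmZ ger0_norm//; lra.
move: (nm (avg _ _)) (nm (avg _ _)) (nm (_ + _)) (nm (_ - _)) p0 pd q0 qd.
by move=> a b s t a0 ad b0 bd sm; nra.
Qed.

End MeanErgodic.

(** * The space of square integrable functions *)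

Section L2.
Context d (X : measurableType d) (R : realType) (mu : probability X R).
Local Notation L2 := (LfunType mu (lee1n 2)).
Implicit Types f g h : L2.

Lemma L2P f : (f : X -> R) \in Lfun mu 2%:E.
Proof. exact: LfunP. Qed.

Definition norm2 (f : X -> R) : R := fine 'N[mu]_2%:E[EFin \o f]%E.

Lemma norm2E f : (norm2 f)%:E = 'N[mu]_2%:E[EFin \o f]%E.
Proof. exact: finite_norm_fine. Qed.

Lemma norm2_ge0 f : 0 <= norm2 f.
Proof. by rewrite fine_ge0// Lnorm_ge0. Qed.

Lemma norm2D f g : norm2 (f + g)%R <= norm2 f + norm2 g.
Proof. exact: ler_LnormD. Qed.

Lemma norm2Z (c : R) f : norm2 (c *: f)%R = `|c| * norm2 f.
Proof. by apply: EFin_inj; rewrite EFinM !norm2E -LnormZ. Qed.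

Lemma norm2N f : norm2 (- f)%R = norm2 f.
Proof. by rewrite -scaleN1r norm2Z normrN1 mul1r. Qed.

Lemma integrableM2 f g : mu.-integrable setT (EFin \o (fun x => f x * g x)).
Proof. by apply/Lfun1_integrable/Lfun2_mul_Lfun1; exact: L2P. Qed.

Lemma innerC (f g : X -> R) : inner mu f g = inner mu g f.
Proof. by apply: eq_Rintegral => x _; rewrite mulrC. Qed.

Lemma innerDl f g h : inner mu (f + g)%R h = inner mu f h + inner mu g h.
Proof.
rewrite /inner -RintegralD//; try exact: integrableM2.
by apply: eq_Rintegral => x _; rewrite -mulrDl.
Qed.

Lemma innerZl (c : R) f g : inner mu (c *: f)%R g = c * inner mu f g.
Proof.
rewrite /inner -RintegralZl//; last exact: integrableM2.
by apply: eq_Rintegral => x _; rewrite mulrA.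
Qed.

Lemma innerNl f g : inner mu (- f)%R g = - inner mu f g.
Proof. by rewrite -scaleN1r innerZl mulN1r. Qed.

Lemma innerBl f g h : inner mu (f - g)%R h = inner mu f h - inner mu g h.
Proof. by rewrite innerDl innerNl. Qed.

Lemma innerDr f g h : inner mu f (g + h)%R = inner mu f g + inner mu f h.
Proof. by rewrite innerC innerDl !(innerC _ f). Qed.

Lemma innerNr f g : inner mu f (- g)%R = - inner mu f g.
Proof. by rewrite innerC innerNl innerC. Qed.

Lemma norm2_sqr f : norm2 f ^+ 2 = inner mu f f.
Proof.
apply: EFin_inj; rewrite -powR_mulrn ?norm2_ge0// -poweR_EFin norm2E.
rewrite powR_Lnorm// /inner /Rintegral fineK; last first.
  exact: integrable_fin_num (integrableM2 f f).
apply: eq_integral => x _ /=.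
by rewrite powR_mulrn// real_normK ?num_real.
Qed.

Lemma norm2_parallelogram f g :
  norm2 (f + g)%R ^+ 2 + norm2 (f - g)%R ^+ 2 =
  2 * norm2 f ^+ 2 + 2 * norm2 g ^+ 2.
Proof.
rewrite !norm2_sqr !(innerDl, innerDr, innerNl, innerNr) (innerC g f).
by ring.
Qed.

Lemma inner_le_norm2 f g : `|inner mu f g| <= norm2 f * norm2 g.
Proof.
rewrite -lee_fin EFin_normr_Rintegral//; last exact: integrableM2.
rewrite (le_trans (le_abse_integral _ _ _))//.
  by have /integrableP[] := integrableM2 f g.
rewrite EFinM !norm2E -Lnorm1.
by apply: hoelder => //; rewrite [RHS]splitr !div1r.
Qed.

Lemma eq_ae_inner f g h : f = g %[ae mu] -> inner mu f h = inner mu g h.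
Proof.
move=> fg; congr fine; apply: ae_eq_integral => //.
- by have /integrableP[] := integrableM2 f h.
- by have /integrableP[] := integrableM2 g h.
- by apply: filterS fg => x /(_ I) fgx _; rewrite fgx.
Qed.

Lemma norm2_eq0 f : norm2 f = 0 -> f = cst 0 %[ae mu].
Proof. exact: fine_Lnormr_eq0. Qed.

Lemma norm2_ae f g : f = g %[ae mu] -> norm2 f = norm2 g.
Proof.
move=> fg; apply/eqP; rewrite -(@eqrXn2 _ 2)// ?norm2_ge0//; apply/eqP.
by rewrite !norm2_sqr (eq_ae_inner f fg) innerC (eq_ae_inner g fg).
Qed.

End L2.

(** * Completeness of L^2 and almost everywhere statements *)

Section Completeness.
Context d (X : measurableType d) (R : realType) (mu : probability X R).
Local Notation L2 := (LfunType mu (lee1n 2)).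

(** Hölder's inequality against the constant 1, whose norm is 1 because mu is a probability. *)
Lemma integral_normr_le_norm2 (f : L2) :
  (\int[mu]_x `|(f x)%:E| <= (norm2 mu f)%:E)%E.
Proof.
have mf : measurable_fun setT (f : X -> R) by [].
have := @hoelder _ _ _ mu f (cst (1 : R)) 2 2 mf (measurable_cst _).
rewrite -norm2E Lnorm_cst1 Lnorm1.
rewrite [X in (_ * X `^ _)%E](_ : _ = 1%E); last first.
  exact: probability_setT.
rewrite poweR1r mule1.
have -> : (f \* cst 1)%R = f by apply/funext => x /=; rewrite mulr1.
by apply => //; rewrite [RHS]splitr !div1r.
Qed.

Lemma Lfun2_sqr_integral (f : X -> R) (c : R) : measurable_fun setT f ->
  (\int[mu]_x (f x ^+ 2)%:E <= c%:E)%E -> f \in Lfun mu 2%:E.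
Proof.
move=> mf fc; apply/andP; split; rewrite inE//= /finite_norm unlock.
apply: poweR_lty; apply: le_lt_trans (ltry c); apply: le_trans fc.
apply: ge0_le_integral => //.
- by move=> x _; rewrite lee_fin powR_ge0.
- apply/measurable_EFinP.
  by apply: (@measurableT_comp _ _ _ _ _ _ (@powR R ^~ 2)) => //;
    exact: measurableT_comp.
- by apply/measurable_EFinP; exact: measurable_funX.
- by move=> x _; rewrite /= lee_fin powR_mulrn// real_normK ?num_real.
Qed.

Lemma integral_sqr (f : L2) :
  (\int[mu]_x (f x ^+ 2)%:E = (norm2 mu f ^+ 2)%:E)%E.
Proof.
rewrite norm2_sqr /inner /Rintegral fineK//.
by apply: integrable_fin_num (integrableM2 f f).
Qed.

(** The sum of the absolute increments has integral at most 2, so it is finite almost everywhere and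
    the telescoping series converges absolutely there. *)
Lemma ae_is_cvg_summable (v : nat -> L2) :
  (forall k, norm2 mu (v k.+1 - v k)%R <= 2^-1 ^+ k) ->
  {ae mu, forall x, cvgn (fun k => v k x)}.
Proof.
move=> vk; pose D k x : \bar R := `|((v k.+1 - v k)%R x)%:E|%E.
have mD k : measurable_fun setT (D k).
  by apply: measurableT_comp => //; apply/measurable_EFinP.
have D0 k x : setT x -> (0 <= D k x)%E by rewrite abse_ge0.
have intD : mu.-integrable setT (fun x => \sum_(0 <= k <oo) D k x)%E.
  apply/integrableP; split.
    by apply: ge0_emeasurable_sum => // k x Dx _; exact: D0.
  rewrite (eq_integral (fun x => \sum_(0 <= k <oo) D k x)%E); last first.
    by move=> x _; rewrite gee0_abs// nneseries_ge0// => k _ _; exact: D0.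
  rewrite integral_nneseries//.
  apply: (@le_lt_trans _ _ 2%:E); last exact: ltry.
  apply: lime_le.
    by apply: is_cvg_nneseries => n _ _; apply: integral_ge0 => x; exact: D0.
  apply: nearW => n.
  apply: (@le_trans _ _ (\sum_(0 <= k < n) (2^-1 ^+ k)%:E)%E).
    apply: lee_sum => k _; apply: (le_trans (integral_normr_le_norm2 _)).
    by rewrite lee_fin.
  rewrite sumEFin lee_fin; apply: (@le_trans _ _ (2 - 2 * 2^-1 ^+ n)).
    elim: n => [|n IH]; first by rewrite big_nil expr0; lra.
    by rewrite big_nat_recr//= exprS; lra.
  by rewrite gerBl mulr_ge0// exprn_ge0.
have := integrable_ae measurableT intD; apply: filterS => x /(_ I) Dx.
rewrite (_ : (fun k => v k x) =
    (fun k => v 0 x + series (telescope (fun k => v k x)) k)); last first.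
  by apply/funext => k; rewrite -eq_sum_telescope.
apply: is_cvgD; first exact: is_cvg_cst.
apply: normed_cvg; apply: nondecreasing_is_cvgn.
  by apply: nondecreasing_series => n _ _; exact: normr_ge0.
exists (fine (\sum_(0 <= k <oo) D k x)%E) => _ [n _ <-].
rewrite -lee_fin fineK// -sumEFin.
by apply: (nneseries_lim_ge n) => k _ _; exact: D0.
Qed.

(** Riesz-Fischer: a rapidly Cauchy subsequence converges almost everywhere, and Fatou's lemma
    carries the Cauchy estimate over to the limit. *)
Lemma norm2_complete (u : nat -> L2) :
  (forall e, 0 < e -> exists N, forall p q, (N <= p)%N -> (N <= q)%N ->
    norm2 mu (u p - u q)%R <= e) ->
  exists h : L2, forall e, 0 < e -> exists N, forall p, (N <= p)%N ->
    norm2 mu (u p - h)%R <= e.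
Proof.
move=> uC; have /choice[N NP] : forall k, exists N, forall p q,
    (N <= p)%N -> (N <= q)%N -> norm2 mu (u p - u q)%R <= 2^-1 ^+ k.
  by move=> k; apply: uC; rewrite exprn_gt0.
(* Nondecreasing, beyond N k, and at least k, so the subsequence eventually passes any threshold
   M. *)
pose n k := (k + \sum_(j < k.+1) N j)%N; pose v k := u (n k).
have Nn k : (N k <= n k)%N by rewrite /n big_ord_recr/= addnA leq_addl.
have nS k : (n k <= n k.+1)%N.
  by rewrite /n leq_add// [leqRHS]big_ord_recr leq_addr.
have cv : {ae mu, forall x, cvgn (fun k => v k x)}.
  apply: ae_is_cvg_summable => k; apply: NP => //.
  by rewrite (leq_trans (Nn _)).
(* The upper limit is measurable everywhere and equals the limit where that exists; [fine] sends
   infinite values, confined to a null set, to 0. *)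
pose h x : R := fine (limn_esup (fun k => (v k x)%:E)).
have mh : measurable_fun setT h.
  apply: measurableT_comp => //; apply: measurable_fun_limn_esup => k.
  exact/measurable_EFinP.
have hv : {ae mu, forall x, (fun k => v k x) @ \oo --> h x}.
  apply: filterS cv => x cvx; suff -> : h x = limn (fun k => v k x) by [].
  have : (fun k => (v k x)%:E) @ \oo --> (limn (fun k => v k x))%:E.
    by apply: cvg_EFin => //; apply: nearW.
  by move=> /cvg_limn_einf_sup[_]; rewrite /h => ->.
have hu e : 0 < e -> exists M, forall p, (M <= p)%N ->
    (\int[mu]_x ((u p x - h x) ^+ 2)%:E <= (e ^+ 2)%:E)%E.
  move=> e0; have [M MP] := uC _ e0; exists M => p Mp.
  have Mn j : (M <= n (j + M))%N by rewrite /n -addnA addnCA leq_addr.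
  pose w j x := ((u p x - v (j + M)%N x) ^+ 2)%:E.
  have w0 j x : setT x -> (0 <= w j x)%E by rewrite lee_fin sqr_ge0.
  have mw j : measurable_fun setT (w j).
    by apply/measurable_EFinP; apply: measurable_funX; exact: measurable_funB.
  have wc j : (\int[mu]_x w j x <= (e ^+ 2)%:E)%E.
    have -> : (\int[mu]_x w j x = (norm2 mu (u p - v (j + M)%N)%R ^+ 2)%:E)%E.
      exact: (integral_sqr (u p - v (j + M)%N)%R).
    by rewrite lee_fin lerXn2r ?nnegrE ?norm2_ge0 ?(ltW e0)//; exact: MP.
  have -> : (\int[mu]_x ((u p x - h x) ^+ 2)%:E =
      \int[mu]_x limn_einf (w ^~ x))%E.
    apply: ae_eq_integral => //.
    - by apply/measurable_EFinP; apply: measurable_funX; exact: measurable_funB.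
    - apply: measurableT_comp => //; apply: measurable_fun_limn_esup => j.
      exact: measurableT_comp.
    apply: filterS hv => x hvx _.
    suff /cvg_limn_einf_sup[-> _] : w ^~ x @ \oo --> ((u p x - h x) ^+ 2)%:E.
      by [].
    apply: cvg_EFin; first exact: nearW.
    rewrite (_ : fine \o w ^~ x =
        (fun y => y ^+ 2) \o (fun j => u p x - v (j + M)%N x))//.
    apply: continuous_cvg; first exact: exprn_continuous.
    apply: cvgB; first exact: cvg_cst.
    by rewrite (cvg_shiftn M (fun k => v k x)).
  apply: (le_trans (fatou _ _ _ _)) => //; rewrite limn_einf_lim.
  apply: lime_le; first exact: is_cvg_einfs.
  apply: nearW => j; apply: le_trans (wc j).
  by apply: ereal_inf_lbound; exists j => /=.
have hL : h \in Lfun mu 2%:E.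
  have [M /(_ M (leqnn M)) hM] := hu 1 ltr01.
  (* The estimate controls only differences with h, so h is recovered as a difference of two square
     integrable functions. *)
  have -> : h = (u M : X -> R) - (u M \- h).
    by apply/funext => x /=; rewrite !fctE subKr.
  have uhL : (u M : X -> R) \- h \in Lfun mu 2%:E.
    by apply: Lfun2_sqr_integral hM; exact: measurable_funB.
  exact: (L2P (u M - Lfun_Sub (lee1n 2) uhL)%R).
exists (Lfun_Sub (lee1n 2) hL) => e e0.
have [M MP] := hu _ e0; exists M => p Mp.
rewrite -(@ler_pXn2r _ 2) ?nnegrE ?norm2_ge0 ?(ltW e0)//.
rewrite -lee_fin -integral_sqr; exact: MP.
Qed.

Lemma sumL2E I (s : seq I) (F : I -> L2) x :
  (\sum_(i <- s) F i)%R x = \sum_(i <- s) F i x.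
Proof.
elim: s => [|i s IH]; first by rewrite !big_nil.
by rewrite !big_cons -IH.
Qed.

Lemma inner_suml I (s : seq I) (F : I -> L2) (psi : L2) :
  inner mu (\sum_(i <- s) F i)%R psi = \sum_(i <- s) inner mu (F i) psi.
Proof.
elim: s => [|i s IH]; last by rewrite !big_cons innerDl IH.
by rewrite !big_nil -(scale0r (0 : L2)) innerZl mul0r.
Qed.

Lemma norm2_sum I (s : seq I) (F : I -> L2) :
  norm2 mu (\sum_(i <- s) F i)%R <= \sum_(i <- s) norm2 mu (F i).
Proof.
elim: s => [|i s IH].
  rewrite !big_nil; have := norm2Z 0 (0 : L2).
  by rewrite scale0r normr0 mul0r => ->.
by rewrite !big_cons (le_trans (norm2D _ _))// lerD2l.
Qed.

Lemma ae_forall_countable (T : countType) (P : T -> X -> Prop) :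
  (forall t, {ae mu, forall x, P t x}) -> {ae mu, forall x, forall t, P t x}.
Proof.
move=> Pae.
have : {ae mu, forall x, forall n,
    if @choice.unpickle T n is Some t then P t x else True}.
  apply: ae_foralln => n.
  by case: (choice.unpickle n) => [t|]; [exact: Pae|exact: aeW].
apply: filterS => x Px t; have := Px (choice.pickle t).
by rewrite choice.pickleK.
Qed.

Lemma Lfun_infty_bounded (f : X -> R) : f \in Lfun mu +oo%E ->
  exists C : nat, {ae mu, forall x, `|f x| <= C%:R}.
Proof.
move=> /andP[_]; rewrite inE /= /finite_norm unlock.
have -> : (0 < mu [set: X])%E by rewrite [X in (_ < X)%E]probability_setT lte01.
move=> /ess_sup_inf.ess_supr_bounded[M fM]; exists (Num.truncn `|M|).+1.
apply: filterS fM => x fx; apply: (le_trans fx).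
by rewrite (le_trans (ler_norm M))// ltW// truncnS_gt.
Qed.

End Completeness.

(** * Directions and sublattices of Z^2 *)

(** The determinant of v and w, an integer test for proportionality. *)
Definition cross (v w : Z2) : int := v.1 * w.2 - w.1 * v.2.

Lemma pairMzE (v : Z2) (n : int) : v *~ n = (v.1 * n, v.2 * n).
Proof.
have E (x : int) k : x *+ k = x * k%:Z by rewrite -mulr_natr natz.
case: n => n; last rewrite NegzE mulrNz; rewrite -pmulrn pairMnE !E//.
by rewrite !mulrN.
Qed.

Lemma crossMzl w n x : cross (w *~ n) x = n * cross w x.
Proof. by rewrite pairMzE /cross /=; ring. Qed.

Lemma cross_antisym w x : cross x w = - cross w x.
Proof. by rewrite /cross; ring. Qed.

Lemma common_multiple v w : v != 0 -> w != 0 -> cross v w = 0 ->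
  exists m n : int, v *~ m = w *~ n /\ v *~ m != 0.
Proof.
case: v w => [v1 v2] [w1 w2]; rewrite /cross /= !xpair_eqE => v0 w0 /eqP.
(* If v1 = 0 both vectors are vertical and the second coordinates serve as multipliers; otherwise
   the first ones do. *)
rewrite subr_eq0 => /eqP vw; have [v10|v10] := eqVneq v1 0.
  rewrite v10 eqxx mul0r /= in v0 vw; have /eqP := esym vw.
  rewrite mulf_eq0 (negPf v0) orbF => /eqP w10; rewrite w10 eqxx /= in w0.
  exists w2, v2; rewrite !pairMzE /= v10 w10 !mul0r mulrC; split => //.
  by rewrite xpair_eqE eqxx mulf_neq0.
exists w1, v1; rewrite !pairMzE /= [v1 * w1]mulrC [v2 * w1]mulrC -vw.
rewrite [w2 * v1]mulrC; split => //; rewrite xpair_eqE; apply: contraNN w0.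
rewrite !mulf_eq0 (negPf v10) orbF => /andP[/eqP w10].
by rewrite w10 eqxx.
Qed.

Lemma not_proportional v w : cross v w != 0 -> ~ proportional v w.
Proof.
move=> vw; apply/negP; rewrite negbK free_cons seq1_free span_seq1.
apply/andP; split.
  apply/negP => /vlineP[k [v1 v2]]; move/negP: vw; apply.
  rewrite -(intr_eq0 rat) /cross rmorphB !rmorphM /= v1 v2.
  by apply/eqP; rewrite /GRing.scale /=; ring.
apply: contra_neq vw => -[/eqP]; rewrite intr_eq0 => /eqP w1 /eqP.
by rewrite intr_eq0 => /eqP w2; rewrite /cross w1 w2 mulr0 mul0r.
Qed.

Definition multiples (c : int) : {pred Z2} :=
  [pred h : Z2 | (c %| h.1)%Z && (c %| h.2)%Z].

(** Reducing both coordinates mod c gives at most c^2 coset representatives. *)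
Lemma finite_index_multiples (c : int) : c != 0 ->
  finite_index_subgroup (multiples c).
Proof.
move=> c0; split.
  split; first by rewrite inE /= !dvdz0.
  by move=> g h /andP[g1 g2] /andP[h1 h2]; rewrite inE /= !rpredB.
pose r (p : nat * nat) : set Z2 :=
  [set h : Z2 | h - (p.1%:Z, p.2%:Z) \in multiples c].
apply: (@sub_finite_set _ _ (r @` (`I_(absz c) `*` `I_(absz c)))); last first.
  by apply: finite_image; apply: finite_setX; exact: finite_II.
have rem_lt (x : int) : (absz (x %% c)%Z < absz c)%N.
  by rewrite -ltz_nat gez0_abs ?modz_ge0// ltz_mod.
have dvd_rem (x y : int) : (c %| x - (y %% c)%Z)%Z = (c %| x - y)%Z.
  by rewrite -!eqz_mod_dvd modz_mod.
move=> _ [g _ <-]; exists (absz (g.1 %% c)%Z, absz (g.2 %% c)%Z).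
  by split; exact: rem_lt.
by apply/seteqP; split => h;
  rewrite /r /= !inE /= !gez0_abs ?modz_ge0// !dvd_rem.
Qed.

(** * The Koopman representation *)

Section Koopman.
Context d (X : measurableType d) (R : realType) (mu : probability X R).
Local Notation L2 := (LfunType mu (lee1n 2)).
Context (a : Z2 -> X -> X) (ha : measure_preserving_action mu a).
Implicit Types (f p : L2) (g h : Z2).

Let act0 x : a 0 x = x. Proof. by case: ha. Qed.
Let actD g h x : a (g + h) x = a g (a h x). Proof. by case: ha. Qed.
Let act_measurable g : measurable_fun setT (a g). Proof. by case: ha. Qed.
Let act_mu g A : measurable A -> mu (a g @^-1` A) = mu A.
Proof. by case: ha => _ _ _; exact. Qed.

Lemma ae_act g (P : X -> Prop) :
  {ae mu, forall x, P x} -> {ae mu, forall x, P (a g x)}.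
Proof.
move=> [A [mA A0 PA]]; exists (a g @^-1` A); split.
- by rewrite -[X in measurable X]setTI; exact: act_measurable.
- by rewrite act_mu.
- by move=> x /= Px; exact: PA.
Qed.

Lemma integral_act g (F : X -> \bar R) : measurable_fun setT F ->
  (forall x, (0 <= F x)%E) -> (\int[mu]_x F (a g x) = \int[mu]_x F x)%E.
Proof.
move=> mF F0; have mg := act_measurable g.
transitivity (\int[pushforward mu (a g)]_x F x)%E.
  by rewrite (ge0_integral_pushforward mg)// => x _.
by apply: eq_measure_integral => A mA _; exact: act_mu.
Qed.

Lemma umul_Lfun g f : umul a g f \in Lfun mu 2%:E.
Proof.
have mf : measurable_fun setT (umul a g f) by apply: measurableT_comp.
apply: (Lfun2_sqr_integral (c := norm2 mu f ^+ 2) mf).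
rewrite -integral_sqr (integral_act (- g) (F := fun x => (f x ^+ 2)%:E))//.
- by apply/measurable_EFinP; exact: measurable_funX.
- by move=> x; rewrite lee_fin sqr_ge0.
Qed.

Definition koopman g f : L2 := Lfun_Sub (lee1n 2) (umul_Lfun g f).

Lemma koopman_is_linear g : linear (koopman g).
Proof. by move=> c f1 f2; apply/LfuneqP. Qed.

HB.instance Definition _ g :=
  GRing.isLinear.Build R L2 L2 *:%R (koopman g) (koopman_is_linear g).

Lemma koopmanD g h f : koopman (g + h) f = koopman g (koopman h f).
Proof. by apply/LfuneqP => x; rewrite /= /umul /= /umul opprD addrC actD. Qed.

Lemma koopman0 f : koopman 0 f = f.
Proof. by apply/LfuneqP => x; rewrite /= /umul oppr0 act0. Qed.

Lemma koopmanC g h f : koopman g (koopman h f) = koopman h (koopman g f).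
Proof. by rewrite -!koopmanD addrC. Qed.

Lemma norm2_koopman g f : norm2 mu (koopman g f) = norm2 mu f.
Proof.
apply/eqP; rewrite -(@eqrXn2 _ 2) ?norm2_ge0//; apply/eqP.
apply: EFin_inj; rewrite -!integral_sqr.
rewrite -(integral_act (- g) (F := fun x => (f x ^+ 2)%:E))//.
- by apply/measurable_EFinP; exact: measurable_funX.
- by move=> x; rewrite lee_fin sqr_ge0.
Qed.

(** Polarization: the inner product is determined by the norm, which is preserved. *)
Lemma inner_koopman g f p :
  inner mu (koopman g f) (koopman g p) = inner mu f p.
Proof.
have polar (u v : L2) : inner mu u v =
    (norm2 mu (u + v)%R ^+ 2 - norm2 mu (u - v)%R ^+ 2) / 4.
  rewrite !norm2_sqr !(innerDl, innerDr, innerNl, innerNr) (innerC mu v u).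
  by field.
by rewrite polar -linearD -linearB !norm2_koopman -polar.
Qed.

Lemma koopman_ae g f p : f = p %[ae mu] -> koopman g f = koopman g p %[ae mu].
Proof.
by move=> fp; apply: (ae_act (- g) (P := fun x => setT x -> f x = p x)).
Qed.

(** * Invariant vectors, the mean ergodic theorem and orthogonal projections *)

Definition stabilizes g f := koopman g f = f %[ae mu].

Lemma stabilizes0 f : stabilizes 0 f.
Proof. by rewrite /stabilizes koopman0; exact: ae_eq_refl. Qed.

Lemma stabilizesD g h f : stabilizes g f -> stabilizes h f ->
  stabilizes (g + h) f.
Proof.
move=> fg fh; rewrite /stabilizes koopmanD.
exact: ae_eq_trans (koopman_ae g fh) fg.
Qed.

Lemma stabilizesN g f : stabilizes g f -> stabilizes (- g) f.
Proof.
move=> /(koopman_ae (- g)); rewrite -koopmanD addNr koopman0.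
exact: ae_eq_sym.
Qed.

Lemma stabilizesMz g f (n : int) : stabilizes g f -> stabilizes (g *~ n) f.
Proof.
move=> fg; have pos (k : nat) : stabilizes (g *+ k) f.
  elim: k => [|k IH]; first exact: stabilizes0.
  by rewrite (mulrS g); exact: stabilizesD.
by case: n => n; rewrite ?NegzE ?mulrNz -pmulrn//; exact: stabilizesN.
Qed.

Lemma stabilizes_ae g f p : f = p %[ae mu] -> stabilizes g f -> stabilizes g p.
Proof.
move=> fp fg; apply: ae_eq_trans (ae_eq_trans fg fp).
exact/koopman_ae/ae_eq_sym.
Qed.

Lemma stabilizes_lin g (c : R) f p : stabilizes g f -> stabilizes g p ->
  stabilizes g (c *: f + p)%R.
Proof.
move=> fg pg; rewrite /stabilizes linearP.
apply: filterS2 fg pg => x fx px xT.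
by rewrite -[LHS]/(c * koopman g f x + koopman g p x) fx// px.
Qed.

Lemma stabilizesP g f : norm2 mu (koopman g f - f)%R = 0 -> stabilizes g f.
Proof.
by move=> /norm2_eq0; apply: filterS => x fx xT; apply/subr0_eq/fx.
Qed.

(** The limit of the averages exists by completeness. It is invariant because shifting an average
    costs O(1/n), and f - p is orthogonal to invariant psi because averaging does not change the
    pairing with psi. *)
Lemma mean_ergodic g f : exists p, [/\ stabilizes g p,
  forall psi : L2, stabilizes g psi -> inner mu (f - p)%R psi = 0 &
  forall e, 0 < e -> exists N, forall n, (N <= n)%N ->
    norm2 mu (avg (koopman g) n f - p)%R <= e].
Proof.
pose A n := avg (koopman g) n f.
have [|p Ap] := @norm2_complete _ _ _ mu A.
  move=> e e0; have e2 : 0 < e ^+ 2 by rewrite exprn_gt0.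
  have [N NP] := mean_ergodic_cauchy (@norm2Z _ _ _ mu) (@norm2D _ _ _ mu)
    (@norm2_parallelogram _ _ _ mu) (@norm2_koopman g) f e2.
  exists N => m n Nm Nn; have := NP _ _ Nm Nn.
  by rewrite ler_pXn2r// ?nnegrE ?norm2_ge0 ?ltW.
exists p; split => //.
- apply: stabilizesP; apply: eq0_of_le_pos; last exact: norm2_ge0.
  move=> e e0; have e3 : 0 < e / 3 by rewrite divr_gt0.
  have [N NP] := Ap _ e3; have [M MP] := div_nat_le (2 * norm2 mu f) e3.
  have {NP} := NP _ (leq_maxl N M); have {MP} := MP _ (leq_maxr N M).
  set n := maxn N M => fn Apn.
  have UA : koopman g (A n) = avg (koopman g) n (koopman g f).
    rewrite /A /avg linearZ linear_sum; congr (_ *: _)%R.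
    by apply: eq_bigr => k _; rewrite -iterS iterSr.
  have -> : (koopman g p - p = (koopman g (p - A n) +
      (avg (koopman g) n (koopman g f) - A n)) + (A n - p))%R.
    by rewrite linearB /= UA !addrA !subrK.
  apply: (le_trans (norm2D _ _)).
  apply: (le_trans (lerD (norm2D _ _) (lexx _))).
  rewrite norm2_koopman -opprB norm2N.
  have := seminorm_avg_shift (@norm2Z _ _ _ mu) (@norm2D _ _ _ mu)
    (@norm2_koopman g) n f.
  by rewrite -/(A n); lra.
- move=> psi gpsi.
  have Apsi n : (0 < n)%N -> inner mu (A n) psi = inner mu f psi.
    move=> n0.
    have iterpsi k : inner mu (iter k (koopman g) f) psi = inner mu f psi.
      elim: k => [//|k <-]; rewrite iterS.
      rewrite -[RHS](inner_koopman g) innerC (innerC mu _ (koopman g psi)).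
      by apply: eq_ae_inner; apply: ae_eq_sym.
    rewrite innerZl; apply: (mulfI (x := n%:R)).
      by rewrite pnatr_eq0 -lt0n.
    rewrite mulrA mulfV ?pnatr_eq0 -?lt0n// mul1r.
    elim: n {n0} => [|n IH].
      by rewrite big_ord0 mul0r -[0%R](scale0r (0 : L2)) innerZl mul0r.
    rewrite big_ord_recr innerDl IH iterpsi.
    by rewrite -[n.+1]addn1 natrD mulrDl mul1r.
  apply/eqP; rewrite -normr_eq0; apply/eqP/eq0_of_le_pos => // e e0.
  (* Adding 1 keeps the divisor positive even when psi has norm 0. *)
  have psi1 : 0 < norm2 mu psi + 1 by rewrite ltr_wpDl// norm2_ge0.
  have [N NP] := Ap _ (divr_gt0 e0 psi1).
  rewrite innerBl -(Apsi N.+1)// -innerBl.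
  apply: (le_trans (inner_le_norm2 _ _)).
  have := NP _ (leqnSn N); rewrite ler_pdivlMr//; apply: le_trans.
  by rewrite ler_wpM2l ?norm2_ge0// lerDl.
Qed.

(** The ergodic limit witnesses existence, so the choice in [orth_proj] never falls back on its
    default. *)
Lemma iproj_is_orth_proj g f :
  is_orth_proj mu (invariant_space mu a g) f (iproj mu a f g).
Proof.
have [p [gp fp _]] := mean_ergodic g f.
apply: (@xgetPex _ (cst 0)
  [set q | is_orth_proj mu (invariant_space mu a g) f q]).
exists (p : X -> R); split; first by split => //; exact: L2P.
by move=> psi [psiL gpsi]; exact: (fp (Lfun_Sub (lee1n 2) psiL)).
Qed.

Lemma iproj_Lfun g f : iproj mu a f g \in Lfun mu 2%:E.
Proof. by have [[]] := iproj_is_orth_proj g f. Qed.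

Definition proj g f : L2 := Lfun_Sub (lee1n 2) (iproj_Lfun g f).

Lemma stabilizes_proj g f : stabilizes g (proj g f).
Proof. by have [[]] := iproj_is_orth_proj g f. Qed.

Lemma inner_proj g f (psi : L2) : stabilizes g psi ->
  inner mu (f - proj g f)%R psi = 0.
Proof.
move=> gpsi; have [_] := iproj_is_orth_proj g f; apply.
by split => //; exact: L2P.
Qed.

(** The difference of two candidates is invariant, and also orthogonal to every invariant function,
    hence to itself. *)
Lemma proj_unique g f q : stabilizes g q ->
  (forall psi : L2, stabilizes g psi -> inner mu (f - q)%R psi = 0) ->
  proj g f = q %[ae mu].
Proof.
move=> gq fq; set w : L2 := (proj g f - q)%R.
have gw : stabilizes g w.
  rewrite /w addrC -scaleN1r; apply: stabilizes_lin gq _.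
  exact: stabilizes_proj.
have w0 : norm2 mu w = 0.
  apply/eqP; rewrite -sqrf_eq0 norm2_sqr; apply/eqP.
  have wE : w = ((f - q) - (f - proj g f))%R by rewrite opprB addrC subrKA.
  by rewrite {1}wE innerBl fq// inner_proj// subr0.
by apply: filterS (norm2_eq0 w0) => x wx xT; apply/subr0_eq/wx.
Qed.

Lemma avg_cvg_proj g f e : 0 < e -> exists N, forall n, (N <= n)%N ->
  norm2 mu (avg (koopman g) n f - proj g f)%R <= e.
Proof.
have [p [gp fp Ap]] := mean_ergodic g f.
have pE := proj_unique gp fp.
move=> /Ap[N NP]; exists N => n /NP; apply: le_trans.
rewrite (@norm2_ae _ _ _ _ _ (avg (koopman g) n f - p)%R)//.
apply: filterS pE => x /(_ I) px _.
by rewrite -[LHS]/(avg (koopman g) n f x - proj g f x) px.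
Qed.

(** Translation by h is isometric and commutes with translation by g, so it maps the projection of f
    to the projection of u^h f, which is f itself. *)
Lemma stabilizes_proj_comm g h f : stabilizes h f -> stabilizes h (proj g f).
Proof.
move=> hf; apply: ae_eq_sym; apply: proj_unique.
  rewrite /stabilizes koopmanC; apply: koopman_ae; exact: stabilizes_proj.
move=> psi gpsi.
rewrite (@eq_ae_inner _ _ _ _ _ (koopman h (f - proj g f))%R); last first.
  apply: filterS hf => x /(_ I) fx _.
  by rewrite linearB -[LHS]/(f x - koopman h (proj g f) x) -fx.
rewrite -[psi]koopman0 -(subrr h) koopmanD inner_koopman.
apply: inner_proj; rewrite /stabilizes koopmanC; exact: koopman_ae.
Qed.

(** * Sums of invariant functions and of periodic functions *)

Lemma stabilizes_zero g : stabilizes g 0.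
Proof. by rewrite /stabilizes linear0; exact: ae_eq_refl. Qed.

Lemma stabilizes_add g f p : stabilizes g f -> stabilizes g p ->
  stabilizes g (f + p)%R.
Proof. by rewrite -{2}[f]scale1r; exact: stabilizes_lin. Qed.

Lemma stabilizes_scale g (c : R) f : stabilizes g f -> stabilizes g (c *: f)%R.
Proof.
move=> gf; rewrite -[(_ *: _)%R]addr0.
exact: stabilizes_lin gf (stabilizes_zero g).
Qed.

Lemma stabilizes_sum g (I : eqType) (s : seq I) (F : I -> L2) :
  {in s, forall i, stabilizes g (F i)} -> stabilizes g (\sum_(i <- s) F i)%R.
Proof.
move=> gF; rewrite big_seq.
by elim/big_ind : _ => //; [exact: stabilizes_zero|exact: stabilizes_add].
Qed.

(** Invariance under cZ^2: in this form a sum is handled by multiplying the two moduli. *)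
Definition multiperiodic f :=
  exists2 c : int, c != 0 & forall h, stabilizes (h *~ c) f.

Lemma multiperiodic_zero : multiperiodic 0.
Proof. by exists 1 => // h; exact: stabilizes_zero. Qed.

Lemma multiperiodic_add f p :
  multiperiodic f -> multiperiodic p -> multiperiodic (f + p)%R.
Proof.
move=> [b b0 fb] [c c0 pc]; exists (b * c) => [|h]; first by rewrite mulf_neq0.
apply: stabilizes_add; last by rewrite mulrzA; exact: pc.
by rewrite mulrC mulrzA; exact: fb.
Qed.

Lemma multiperiodic_scale (c : R) f :
  multiperiodic f -> multiperiodic (c *: f)%R.
Proof. by move=> [b b0 fb]; exists b => // h; exact: stabilizes_scale. Qed.

Lemma multiperiodic_ae f p :
  f = p %[ae mu] -> multiperiodic f -> multiperiodic p.
Proof. by move=> fp [b b0 fb]; exists b => // h; apply: stabilizes_ae fp _. Qed.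

Lemma multiperiodic_sum (I : eqType) (s : seq I) (F : I -> L2) :
  {in s, forall i, multiperiodic (F i)} -> multiperiodic (\sum_(i <- s) F i)%R.
Proof.
move=> F_per; rewrite big_seq.
by elim/big_ind : _ => //; [exact: multiperiodic_zero|exact: multiperiodic_add].
Qed.

(** Cramer's rule: the determinant times any h is an integer combination of v and w. *)
Lemma multiperiodic_stabilizes v w f :
  stabilizes v f -> stabilizes w f -> cross v w != 0 -> multiperiodic f.
Proof.
move=> vf wf vw0; exists (cross v w) => // h.
have -> : h *~ cross v w = v *~ (h.1 * w.2 - h.2 * w.1) +
    w *~ (h.2 * v.1 - h.1 * v.2).
  by rewrite !pairMzE/cross; congr pair => /=; ring.
by apply: stabilizesD; exact: stabilizesMz.
Qed.

Lemma periodic_L2_multiperiodic f : multiperiodic f -> periodic_L2 mu a f.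
Proof.
move=> [c c0 fc]; split; first exact: L2P.
exists (multiples c); first exact: finite_index_multiples.
move=> h; rewrite inE => /andP[/dvdzP[x h1] /dvdzP[y h2]].
have -> : h = (x, y) *~ c by rewrite pairMzE /= -h1 -h2 -surjective_pairing.
exact: fc.
Qed.

(** * Grouping proportional directions *)

Definition independent_directions (t : seq Z2) (psi : Z2 -> L2) :=
  [/\ uniq t, {in t, forall w, w != 0},
      {in t &, forall w x, w != x -> cross w x != 0} &
      {in t, forall w, stabilizes w (psi w)}].

Lemma independent_directions_cons z chi t psi :
  independent_directions t psi -> z != 0 -> stabilizes z chi ->
  {in t, forall w, cross z w != 0} ->
  exists2 psi', independent_directions (z :: t) psi' &
    \sum_(w <- z :: t) psi' w = (chi + \sum_(w <- t) psi w)%R.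
Proof.
move=> [t_uniq t0 tc tpsi] z0 zchi zt.
have zNt : z \notin t.
  by apply/negP => /zt; rewrite /cross mulrC subrr eqxx.
exists (fun x => if x == z then chi else psi x).
  split => /=.
  - by rewrite zNt.
  - by move=> w; rewrite inE => /predU1P[->//|/t0].
  - move=> w x; rewrite !inE => /predU1P[->|wt] /predU1P[->|xt].
    + by rewrite eqxx.
    + by move=> _; exact: zt.
    + by move=> _; rewrite cross_antisym oppr_eq0; exact: zt.
    + exact: tc.
  - move=> w; rewrite inE => /predU1P[->|wt]; first by rewrite eqxx.
    by case: eqP => [wz|_]; [rewrite -wz wt in zNt|exact: tpsi].
rewrite big_cons eqxx; congr (_ + _)%R; apply: eq_big_seq => w wt.
by case: eqP => [wz|//]; rewrite -wz wt in zNt.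
Qed.

(** Summands are inserted one by one. When the new direction is proportional to a present w, both
    are replaced by a nonzero common multiple, which stabilizes both functions and, being a multiple
    of w, stays independent of the rest. *)
Lemma merge_directions (I : eqType) (s : seq I) (v : I -> Z2) (phi : I -> L2) :
  {in s, forall i, v i != 0} -> {in s, forall i, stabilizes (v i) (phi i)} ->
  exists t psi, independent_directions t psi /\
    (\sum_(i <- s) phi i = \sum_(w <- t) psi w)%R.
Proof.
elim: s => [|i s IH] v0 vphi.
  by exists [::], (fun=> 0%R); rewrite !big_nil; split => //; split.
have [||t [psi [tpsi sE]]] := IH.
- by move=> j js; apply: v0; rewrite inE js orbT.
- by move=> j js; apply: vphi; rewrite inE js orbT.
have vi0 : v i != 0 by apply: v0; rewrite mem_head.
have viphi : stabilizes (v i) (phi i) by apply: vphi; rewrite mem_head.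
rewrite big_cons sE.
have [/hasP[w wt /eqP vw]|/hasPn tv] :=
  boolP (has (fun w => cross (v i) w == 0) t).
  have [t_uniq t0 tc tps] := tpsi.
  have [m [n [mn mn0]]] := common_multiple vi0 (t0 _ wt) vw.
  have n0 : n != 0 by apply: contra_neq mn0; rewrite mn => ->; rewrite mulr0z.
  have [||||psi' tpsi' psi'E] := @independent_directions_cons (v i *~ m)
      (phi i + psi w)%R (rem w t) psi.
  - split; first exact: rem_uniq.
    + by move=> x /mem_rem; exact: t0.
    + by move=> x y /mem_rem xt /mem_rem yt; exact: tc.
    + by move=> x /mem_rem; exact: tps.
  - by [].
  - apply: stabilizes_add; first exact: stabilizesMz.
    by rewrite mn; apply: stabilizesMz; exact: tps.
  - move=> x; rewrite mem_rem_uniq// inE => /andP[xw xt].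
    by rewrite mn crossMzl mulf_neq0// tc// eq_sym.
  exists (v i *~ m :: rem w t), psi'; split => //.
  by rewrite psi'E [in LHS](big_rem w)//= addrA.
have [|psi' tpsi' psi'E] := independent_directions_cons tpsi vi0 viphi.
  by move=> w /tv.
by exists (v i :: t), psi'.
Qed.

(** * Decomposition of f into functions invariant under one vector *)

Lemma proj0 f : proj 0 f = f %[ae mu].
Proof.
apply: proj_unique; first exact: stabilizes0.
by move=> psi _; rewrite subrr -(scale0r (0 : L2)) innerZl mul0r.
Qed.

Lemma koopmanMn g k f : koopman (g *+ k) f = iter k (koopman g) f.
Proof.
elim: k => [|k IH]; first by rewrite mulr0n koopman0.
by rewrite (mulrS g) koopmanD IH.
Qed.

(** For almost every x, the values of f along the orbit of x form a bounded integer function on Z^2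
    annihilated by the polynomial. Countability of Z^2 gives one null set for all translates. *)
Lemma ae_dilation f (C : nat) (S : seq Z2) (c : Z2 -> int) (g0 : Z2) :
  let M := (\sum_(g <- S) absz (c g) * C)`! in
  {ae mu, forall x, f x \is a Num.int} -> {ae mu, forall x, `|f x| <= C%:R} ->
  {ae mu, forall x, \sum_(g <- S) (c g)%:~R * umul a g f x = 0} ->
  forall k, (\sum_(g <- S) (c g)%:~R *:
    koopman (g - g0) (iter k (koopman ((g - g0) *+ M)) f))%R = cst 0 %[ae mu].
Proof.
move=> M f_int f_bd f_ann k.
have: {ae mu, forall x, forall h, [/\ f (a (- h) x) \is a Num.int,
    `|f (a (- h) x)| <= C%:R &
    \sum_(g <- S) (c g)%:~R * umul a g f (a (- h) x) = 0]}.
  apply: ae_forall_countable => h.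
  have := ae_act (- h) f_ann; have := ae_act (- h) f_bd.
  have := ae_act (- h) f_int; apply: filterS3 => x; by split.
apply: filterS => x xP _.
pose F h := Num.floor (f (a (- h) x)).
have FE h : (F h)%:~R = f (a (- h) x).
  by have [fint _ _] := xP h; rewrite /F floorK.
have FC h : (absz (F h) <= C)%N.
  have [_ fC _] := xP h; rewrite -lez_nat -(ler_int R) abszE intr_norm FE.
  exact: fC.
have F0 h : \sum_(g <- S) c g * F (h + g) = 0.
  apply/eqP; rewrite -(intr_eq0 R) rmorph_sum /=; apply/eqP.
  have [_ _ xh] := xP h; rewrite -[RHS]xh; apply: eq_bigr => g _.
  by rewrite rmorphM /= FE /umul -actD opprD addrC.
(* This base point turns each exponent into (kM + 1)(g - g0) = (g - g0) + kM(g - g0), so k only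
   counts iterates of one operator. *)
have := sum_dilation_progression FC F0 k (- (g0 *+ (k * M).+1)).
move=> /(congr1 (fun m : int => m%:~R : R)); rewrite rmorph_sum /= => Fk.
rewrite sumL2E -[RHS]Fk; apply: eq_bigr => g _; rewrite intrM FE.
rewrite -koopmanMn -koopmanD -mulrnA mulnC -mulrS.
by rewrite -[LHS]/(_ * f (a _ x)) mulrnBl [in RHS]addrC.
Qed.

Lemma norm2_avg_combination (S : seq Z2) (c : Z2 -> R) (v w : Z2 -> Z2) f n :
  (forall k, (\sum_(g <- S) c g *: koopman (v g) (iter k (koopman (w g)) f))%R
     = cst 0 %[ae mu]) ->
  norm2 mu (\sum_(g <- S) c g *: koopman (v g) (avg (koopman (w g)) n f))%R = 0.
Proof.
move=> S0; pose T k : L2 :=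
  (\sum_(g <- S) c g *: koopman (v g) (iter k (koopman (w g)) f))%R.
have T0 k : norm2 mu (T k) = 0.
  have := norm2Z 0 (0 : L2); rewrite scale0r normr0 mul0r => z.
  by rewrite -[RHS]z; apply: norm2_ae; exact: S0.
have -> : (\sum_(g <- S) c g *: koopman (v g) (avg (koopman (w g)) n f) =
    n%:R^-1 *: \sum_(k < n) T k)%R.
  rewrite exchange_big scaler_sumr; apply: eq_bigr => g _ /=.
  rewrite /avg linearZ linear_sum.
  by rewrite scalerA mulrC -scalerA scaler_sumr.
apply/eqP; rewrite norm2Z mulf_eq0; apply/orP; right.
rewrite eq_le norm2_ge0 andbT (le_trans (norm2_sum _ _))//.
by rewrite big1// => k _; exact: T0.
Qed.

Lemma norm2_proj_combination (S : seq Z2) (c : Z2 -> R) (v w : Z2 -> Z2) f :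
  (forall k, (\sum_(g <- S) c g *: koopman (v g) (iter k (koopman (w g)) f))%R
     = cst 0 %[ae mu]) ->
  (\sum_(g <- S) c g *: koopman (v g) (proj (w g) f))%R = cst 0 %[ae mu].
Proof.
move=> S0; apply/norm2_eq0/eq0_of_le_pos; last exact: norm2_ge0.
(* Each average is taken within e / K of its projection, so the weighted errors add up to at most e;
   the 1 keeps K positive. *)
move=> e e0; pose K := 1 + \sum_(g <- S) `|c g|.
have K0 : 0 < K by rewrite ltr_pwDl// sumr_ge0.
have /choice[N NP] g := avg_cvg_proj (w g) f (divr_gt0 e0 K0).
pose n := (\sum_(g <- S) N g)%N.
have nN g : g \in S -> (N g <= n)%N.
  by move=> gS; rewrite /n (big_rem g)//= leq_addr.
pose W : L2 := (\sum_(g <- S) c g *: koopman (v g) (proj (w g) f))%R.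
pose T : L2 := (\sum_(g <- S) c g *: koopman (v g) (avg (koopman (w g)) n f))%R.
have TW : norm2 mu (T - W)%R <= e.
  rewrite /T /W -sumrB (le_trans (norm2_sum _ _))//.
  apply: (@le_trans _ _ (\sum_(g <- S) `|c g| * (e / K))).
    rewrite big_seq [leRHS]big_seq; apply: ler_sum => g gS.
    rewrite -scalerBr norm2Z ler_wpM2l// -linearB norm2_koopman.
    by apply: NP; exact: nN.
  by rewrite -mulr_suml mulrCA ger_pMr// ler_pdivrMr// mul1r lerDr.
rewrite -[X in norm2 mu X]/(W : X -> R).
have -> : W = (- (T - W) + T)%R by rewrite opprB subrK.
by rewrite (le_trans (norm2D _ _))// norm2N norm2_avg_combination// addr0.
Qed.

(** In the limiting relation the g0 term is projected to H_0, the whole space, so it is a nonzero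
    multiple of f and the relation can be solved for f. *)
Lemma bounded_integer_decomposition f (C : nat) (S : seq Z2) (c : Z2 -> int) :
  uniq S -> {in S, forall g, c g != 0} -> S != [::] ->
  {ae mu, forall x, f x \is a Num.int} -> {ae mu, forall x, `|f x| <= C%:R} ->
  {ae mu, forall x, \sum_(g <- S) (c g)%:~R * umul a g f x = 0} ->
  exists (s : seq Z2) (v : Z2 -> Z2) (phi : Z2 -> L2),
    [/\ {in s, forall g, v g != 0}, {in s, forall g, stabilizes (v g) (phi g)} &
        f = (\sum_(g <- s) phi g)%R %[ae mu]].
Proof.
case: S => [//|g0 S] S_uniq c0 _ f_int f_bd f_ann.
have := ae_dilation g0 f_int f_bd f_ann.
set M := (_`!)%N => /norm2_proj_combination W0.
have M0 : (0 < M)%N by exact: fact_gt0.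
have cg0 : (c g0)%:~R != 0 :> R by rewrite intr_eq0 c0// mem_head.
exists S, (fun g => (g - g0) *+ M), (fun g => (- ((c g)%:~R / (c g0)%:~R)) *:
  koopman (g - g0) (proj ((g - g0) *+ M) f))%R; split.
- move=> g gS; have gg0 : g - g0 != 0.
    by rewrite subr_eq0; apply: contraTneq S_uniq => <- /=; rewrite gS.
  move: (g - g0) gg0 => [x y]; rewrite pairMnE !xpair_eqE /= !mulrn_eq0.
  by rewrite -[M == 0]negbK -lt0n M0.
- move=> g gS; apply: stabilizes_scale; rewrite /stabilizes koopmanC.
  by apply: koopman_ae; exact: stabilizes_proj.
apply: filterS2 W0 (proj0 f) => x /(_ I) + /(_ I) fx _.
rewrite big_cons subrr mul0rn koopman0 => Wx.
have : (c g0)%:~R * f x + \sum_(g <- S) (c g)%:~R *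
    koopman (g - g0) (proj ((g - g0) *+ M) f) x = 0.
  by rewrite -fx -[RHS]Wx -[RHS]/(_ + (\sum_(g <- S) (c g)%:~R *:
    koopman (g - g0) (proj ((g - g0) *+ M) f))%R x) sumL2E.
move=> /eqP; rewrite addr_eq0 => /eqP fE; apply: (mulfI cg0).
rewrite fE sumL2E mulr_sumr -sumrN; apply: eq_bigr => g _.
transitivity ((c g0)%:~R * (- ((c g)%:~R / (c g0)%:~R) *
  koopman (g - g0) (proj ((g - g0) *+ M) f) x)); last by [].
by rewrite mulrA mulrN mulrCA mulfV// mulr1 mulNr.
Qed.

(** As psi_w already lies in H_(lw), projecting f affects only the other pieces; these remain after
    subtracting psi_w, each invariant under its own x and under lw. *)
Lemma proj_sub_multiperiodic f t psi w (l : nat) :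
  independent_directions t psi -> f = (\sum_(x <- t) psi x)%R %[ae mu] ->
  w \in t -> (0 < l)%N -> multiperiodic (proj (w *+ l) f - psi w)%R.
Proof.
move=> [t_uniq t0 tc tpsi] fE wt l0.
pose q x : L2 := if x == w then psi w else proj (w *+ l) (psi x).
have qw x : stabilizes (w *+ l) (q x).
  rewrite /q; case: eqP => _; last exact: stabilizes_proj.
  by rewrite pmulrn; apply: stabilizesMz; exact: tpsi.
have pE : proj (w *+ l) f = (\sum_(x <- t) q x)%R %[ae mu].
  apply: proj_unique; first by apply: stabilizes_sum => x _; exact: qw.
  move=> chi wchi.
  rewrite (@eq_ae_inner _ _ _ _ _ (\sum_(x <- t) (psi x - q x))%R); last first.
    apply: filterS fE => x /(_ I) fx _; rewrite sumrB.
    by rewrite -[LHS]/(f x - (\sum_(x <- t) q x)%R x) fx.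
  rewrite inner_suml big1// => x _; rewrite /q; case: eqP => [->|_].
    by rewrite subrr -(scale0r (0 : L2)) innerZl mul0r.
  exact: inner_proj.
apply: (@multiperiodic_ae (\sum_(x <- rem w t) q x)%R).
  apply: filterS pE => x /(_ I) px _.
  rewrite -[RHS]/(proj (w *+ l) f x - psi w x) px [in RHS](big_rem w)//.
  rewrite -[RHS]/(q w x + (\sum_(y <- rem w t) q y)%R x - psi w x).
  by rewrite {2}/q eqxx addrC addKr.
apply: multiperiodic_sum => x; rewrite mem_rem_uniq// inE => /andP[xw xt].
rewrite /q (negPf xw); apply: (@multiperiodic_stabilizes x (w *+ l)).
- by apply: stabilizes_proj_comm; exact: tpsi.
- exact: stabilizes_proj.
- rewrite cross_antisym oppr_eq0 pmulrn crossMzl mulf_neq0//.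
    by rewrite -lt0n.
  by apply: tc => //; rewrite eq_sym.
Qed.

End Koopman.

(** * The set of directions and the periodicity of the differences *)

Theorem theorem3p3 (d : measure_display) (X : measurableType d) (R : realType)
    (mu : probability X R) (a : Z2 -> X -> X)
    (ha : measure_preserving_action mu a)
    (f : X -> R) (f_bounded : f \in Lfun mu +oo%E)
    (f_int : {ae mu, forall x, f x \is a Num.int})
    (f_ann : Ann mu a f <> [set [fsfun]]) :
  exists Delta : {fset Z2},
    [/\ forall g, g \in Delta -> g != 0,
        forall g h, g \in Delta -> h \in Delta -> g != h -> ~ proportional g h,
        periodic_L2 mu a (fun x => f x - \sum_(g <- Delta) iproj mu a f g x) &
        forall (l : nat) (g : Z2), (1 <= l)%N -> g \in Delta ->
          periodic_L2 mu a (iproj mu a f (g *+ l) \- iproj mu a f g)].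
Proof.
have [C fC] := Lfun_infty_bounded f_bounded.
have fL : f \in Lfun mu 2%:E.
  have y1 : (1 <= +oo :> \bar R)%E by rewrite leey.
  apply: (Lfun_subset (lee1n 2) y1 _ _ f_bounded); last by rewrite leey.
  by rewrite [X in X \is a fin_num]probability_setT.
pose F : LfunType mu (lee1n 2) := Lfun_Sub (lee1n 2) fL.
(* The zero polynomial always annihilates f, so an annihilator other than {0} contains a nonzero
   p. *)
have [p pf p0] : exists2 p : laurent, Ann mu a f p & p != [fsfun].
  apply: contra_notP f_ann => np; apply/seteqP; split => p /=.
    move=> pf; apply/eqP/negPn/negP => p0; apply: np; by exists p.
  by move=> ->; apply: aeW => x _; rewrite /laurent_act finsupp0 big_nil.
have [|||s [v [phi [v0 vphi fE]]]] := bounded_integer_decomposition ha (f := F)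
    (S := finsupp p) (c := p) (fset_uniq _) _ _ f_int fC _.
- by move=> g; rewrite mem_finsupp.
- apply: contra_neq p0 => p0; apply/fsfunP => g; rewrite fsfun0E.
  apply: fsfun_dflt; apply/negP => gp.
  by have : g \in enum_fset (finsupp p) := gp; rewrite p0.
- by apply: filterS pf => x /(_ I).
have [t [psi [tpsi sE]]] := merge_directions v0 vphi.
rewrite sE in fE; have [t_uniq t0 tc _] := tpsi.
have tE : perm_eq [fset x in t]%fset t.
  by apply: uniq_perm => // x; rewrite inE.
exists [fset x in t]%fset; split.
- by move=> g; rewrite inE; exact: t0.
- move=> g h; rewrite !inE => gt ht gh.
  by apply: not_proportional; exact: tc.
- rewrite (_ : (fun x => _) =
      (F - \sum_(g <- t) proj ha g F)%R :> (X -> R)); last first.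
    apply/funext => x; rewrite (perm_big _ tE).
    by rewrite -[RHS]/(f x - (\sum_(g <- t) proj ha g F)%R x) sumL2E.
  apply: periodic_L2_multiperiodic.
  (* Since f is the sum of the psi_g, f minus the sum of the f^g is the sum of -(f^g - psi_g): the
     case l = 1. *)
  apply: (@multiperiodic_ae _ _ _ _ _ _
    (\sum_(g <- t) (- 1) *: (proj ha (g *+ 1) F - psi g))%R).
    apply: filterS fE => x /(_ I) fx _.
    rewrite -scaler_sumr scaleN1r sumrB opprB.
    by rewrite -[RHS]/(F x - (\sum_(g <- t) proj ha g F)%R x) fx.
  apply: multiperiodic_sum => g gt; apply: multiperiodic_scale.
  exact: proj_sub_multiperiodic tpsi fE gt _.
- move=> l g l0; rewrite inE => gt.
  apply: (periodic_L2_multiperiodic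
    (f := (proj ha (g *+ l) F - proj ha g F)%R)).
  rewrite -[proj ha g F]/(proj ha (g *+ 1) F).
  (* Both projections are compared with psi_g, at l and at 1. *)
  have -> : (proj ha (g *+ l) F - proj ha (g *+ 1) F =
      (proj ha (g *+ l) F - psi g) +
      (-1) *: (proj ha (g *+ 1) F - psi g))%R.
    by rewrite scaleN1r opprB addrA subrK.
  apply: multiperiodic_add; last apply: multiperiodic_scale;
    exact: proj_sub_multiperiodic tpsi fE gt _.
Qed.
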